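(* Let $X$ be a finite dimensional complex Banach space with $\dim_{\mathbb{C}} X=n\ge 1$. Then for any Auerbach basis $\{(x_k,x_k^* ):1\le k\le n\}$ of $X$ there exist $2n+2$ linear combinations $z_1,\dots,z_{2n+2}$ of the vectors $x_1,\dots,x_n$, all of whose coefficients belong to $\{0,1,-1,\mathrm{i},-\mathrm{i}\}$ (where $\mathrm{i}=\sqrt{-1}$), such that $\|z_k\|=1$ for $1\le k\le 2n+2$ and $\|z_k-z_l\|>1$ for $1\le k<l\le 2n+2$.
   Context: An Auerbach basis of an $n$-dimensional complex Banach space $X$ is a family of pairs $\{(x_k,x_k^* ):1\le k\le n\}\subseteq X\times X^*$ ($X^*$ being the space of complex-linear functionals with the dual norm) such that $x_i^*(x_j)=\delta_{ij}$ for all $i,j$ and $\|x_k\|=\|x_k^*\|=1$ for all $k$. *)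

(* Defs.v *)
From HB Require Import structures.
From mathcomp Require Import all_boot all_order all_algebra.
From mathcomp Require Import complex.
From mathcomp Require Import boolp classical_sets reals topology normedtype.

Set Implicit Arguments.
Unset Strict Implicit.
Unset Printing Implicit Defensive.

Import Order.TTheory GRing.Theory Num.Theory.
Import numFieldNormedType.Exports.

Local Open Scope classical_set_scope.
Local Open Scope ring_scope.

#[short(type="finDimBanachType")]
HB.structure Definition FinDimBanach (K : numFieldType) :=
  {X of CompleteNormedModule K X & Vector K X}.

(* The norm of a normed module over [R[i]] takes its values in [R[i]]; they are
   nonnegative, hence real, and the supremum is taken in [R] through [Re].
   In finite dimension this set is bounded. *)
Definition dual_norm (R : realType) (X : finDimBanachType R[i])
    (f : {scalar X}) : R :=
  sup [set complex.Re `|f v| | v in [set v : X | `|v| <= 1]].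

Definition auerbach_basis (R : realType) (X : finDimBanachType R[i])
    (n : nat) (x : 'I_n -> X) (xs : 'I_n -> {scalar X}) : Prop :=
  (forall i j, xs i (x j) = (i == j)%:R) /\
  (forall k, `|x k| = 1 /\ dual_norm (xs k) = 1).

(* Main.v *)
(** Let A be the set of norm-one combinations of the x_j with coefficients in
  {0,1,-1,i,-i}.  The coefficient functionals have norm one, so any two elements
  of A that differ at all are at distance > 1, unless their difference lies
  again in A: a difference of two coefficients is either again 0,1,-1,i,-i
  or has modulus > 1.
  Say that an element leads with u at k if its coefficients before k vanish and
  the k-th one is u, and fix an additive height that is positive on every
  element leading with 1 or i.  Like the simple roots of a root system, the 2n
  elements s_(k,u) of minimal height among those leading with u in {1,i} at k
  have no difference in A.  Like the lowest root, the negatives of the two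
  elements t_u of maximal height among those leading with u at the first
  coordinate can be added to the family: for k beyond the first coordinate, if
  s_(k,u') + t_u were in A, it would lead with u at the first coordinate and be
  higher than t_u; otherwise its first coefficient has modulus > 1. *)

Require Import Defs.
From HB Require Import structures.
From mathcomp Require Import all_boot all_order all_algebra.
From mathcomp Require Import complex.
From mathcomp Require Import boolp classical_sets reals topology normedtype.
From mathcomp Require Import zify lra.

Set Implicit Arguments.
Unset Strict Implicit.
Unset Printing Implicit Defensive.

Import Order.TTheory GRing.Theory Num.Theory.
Import numFieldNormedType.Exports.

Local Open Scope ring_scope.

(** * Coefficients are bounded by the norm *)

Lemma dual_norm1_le (R : realType) (X : finDimBanachType R[i])
    (f : {scalar X}) (v : X) : dual_norm f = 1 -> `|f v| <= `|v|.
Proof.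
rewrite /dual_norm; set E := (X in sup X) => supE.
(* [sup] takes the default value 0 on a set without a supremum, so the value 1 already shows that
   [E] is bounded above. *)
have [_ ubE] : has_sup E.
  by apply: contrapT => /sup_out E0; move/eqP: supE; rewrite E0 eq_sym oner_eq0.
have [->|v0] := eqVneq v 0; first by rewrite linear0 !normr0.
have nv0 : 0 < `|v| by rewrite normr_gt0.
have : complex.Re `|f (`|v|^-1 *: v)| <= 1.
  rewrite -supE; apply: ub_le_sup => //; exists (`|v|^-1 *: v) => //=.
  by rewrite normrZ normfV normr_id mulVf // gt_eqF.
move=> le1; have : `|f (`|v|^-1 *: v)| <= 1.
  by rewrite lecE le1 normc_def /= eqxx.
by rewrite linearZ /= normrM normfV normr_id mulrC ler_pdivrMr // mul1r.
Qed.

Lemma auerbach_coef_le (R : realType) (X : finDimBanachType R[i]) (n : nat)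
    (x : 'I_n -> X) (xs : 'I_n -> {scalar X}) (c : 'I_n -> R[i]) (k : 'I_n) :
  auerbach_basis x xs -> `|c k| <= `|\sum_j c j *: x j|.
Proof.
move=> [dual nrm]; have -> : c k = xs k (\sum_j c j *: x j).
  rewrite linear_sum (bigD1 k) //= big1 => [|j jk].
    by rewrite linearZ /= dual eqxx mulr1 addr0.
  by rewrite linearZ /= dual eq_sym (negbTE jk) mulr0.
by apply: dual_norm1_le; case: (nrm k).
Qed.

(** * Digits and their differences *)

Definition digits (R : realType) : seq R[i] := [:: 0; 1; -1; 'i%C; - 'i%C].

Lemma digitsN (R : realType) (a : R[i]) : a \in digits R -> - a \in digits R.
Proof.
by rewrite !inE => /or4P[|||/orP[]] /eqP->; rewrite ?oppr0 ?opprK eqxx ?orbT.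
Qed.

Lemma digit_norm (R : realType) (a : R[i]) :
  a \in digits R -> a != 0 -> `|a| = 1.
Proof.
rewrite !inE => /or4P[|||/orP[]] /eqP->; rewrite ?eqxx // => _.
all: by rewrite ?normrN ?normr1 // normc_def /= expr0n expr1n add0r sqrtr1.
Qed.

Lemma notin_digits (R : realType) (a : R[i]) : 1 < `|a| -> a \notin digits R.
Proof.
move=> a1; apply/negP => a_d; have a0 : a != 0.
  by apply: contraTneq a1 => ->; rewrite normr0 ltr10.
by move: a1; rewrite digit_norm // ltxx.
Qed.

Lemma digit_sum_ge (R : realType) (a : R[i]) :
  a \in digits R -> -1 <= complex.Re a + complex.Im a.
Proof. by rewrite !inE => /or4P[|||/orP[]] /eqP-> /=; lra. Qed.

Lemma normc_gt1 (R : realType) (z : R[i]) :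
  1 < complex.Re z ^+ 2 + complex.Im z ^+ 2 -> 1 < `|z|.
Proof.
move=> z1; rewrite -(@ltr_pXn2r _ 2) ?nnegrE // expr1n -add_Re2_Im2.
by rewrite ltcE /= eqxx.
Qed.

Lemma digitsB (R : realType) (a b : R[i]) :
  a \in digits R -> b \in digits R -> a - b \in digits R \/ 1 < `|a - b|.
Proof.
move=> a_d b_d; move: (a_d) (b_d); rewrite !inE.
move=> /or4P[|||/orP[]] /eqP-> /or4P[|||/orP[]] /eqP->.
all: try (by left; rewrite ?subrr ?subr0 ?sub0r ?opprK eqxx ?orbT).
all: by right; apply: normc_gt1; rewrite /= !expr2; lra.
Qed.

(** * Norm-one combinations *)

Definition unit_comb (R : realType) (X : finDimBanachType R[i]) (n : nat)
    (x : 'I_n -> X) (c : 'I_n -> R[i]) : Prop :=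
  (forall j, c j \in digits R) /\ `|\sum_j c j *: x j| = 1.

Lemma unit_combN (R : realType) (X : finDimBanachType R[i]) (n : nat)
    (x : 'I_n -> X) (c : 'I_n -> R[i]) :
  unit_comb x c -> unit_comb x (fun j => - c j).
Proof.
move=> [c_d c1]; split=> [j|]; first exact: digitsN.
by under eq_bigr do rewrite scaleNr; rewrite sumrN normrN.
Qed.

(** A coefficient of modulus above 1 in the difference bounds its norm from below. Otherwise all its
    coefficients are digits and the nonzero [k]-th one has modulus 1, so the norm is at least 1, and
    equality is ruled out by the last hypothesis. *)
Lemma unit_combB (R : realType) (X : finDimBanachType R[i]) (n : nat)
    (x : 'I_n -> X) (xs : 'I_n -> {scalar X}) (c d : 'I_n -> R[i]) (k : 'I_n) :
  auerbach_basis x xs -> unit_comb x c -> unit_comb x d -> c k != d k ->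
  ~ unit_comb x (fun j => c j - d j) ->
  1 < `|\sum_j c j *: x j - \sum_j d j *: x j|.
Proof.
move=> hx [c_d _] [d_d _] cdk; rewrite -sumrB.
under [X in `|X|]eq_bigr do rewrite -scalerBl.
have coef_le j := auerbach_coef_le (fun j => c j - d j) j hx.
have [[j cdj] _|cd_small not_unit] :=
    pselect (exists j, 1 < `|c j - d j|); first exact: lt_le_trans (coef_le j).
have cd_d j : c j - d j \in digits R.
  by case: (digitsB (c_d j) (d_d j)) => // cdj; case: cd_small; exists j.
have := coef_le k; rewrite /= digit_norm ?subr_eq0 // le_eqVlt => /orP[/eqP e|//].
by case: not_unit; split.
Qed.

Definition lead (R : realType) (n : nat) (k : 'I_n) (u : R[i])
    (c : 'I_n -> R[i]) : Prop :=
  (forall j : 'I_n, (j < k)%N -> c j = 0) /\ c k = u.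

Lemma unit_comb_basis (R : realType) (X : finDimBanachType R[i]) (n : nat)
    (x : 'I_n -> X) (k : 'I_n) (u : R[i]) :
  `|x k| = 1 -> u \in digits R -> u != 0 ->
  exists c, unit_comb x c /\ lead k u c.
Proof.
move=> xk u_d u0; exists (fun j => if j == k then u else 0).
split; first split=> [j|].
- by case: eqP => _; rewrite // inE eqxx.
- rewrite (bigD1 k) //= eqxx big1 => [|j /negbTE->]; last by rewrite scale0r.
  by rewrite addr0 normrZ xk mulr1 digit_norm.
- by split=> [j|]; [case: eqP => // ->; rewrite ltnn | rewrite eqxx].
Qed.

(** Only finitely many coefficient families take values in [digits R], so [h] attains its minimum;
    they are encoded as finite functions into [seq_sub (digits R)]. *)
Lemma unit_comb_min (R : realType) (X : finDimBanachType R[i]) (n : nat)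
    (x : 'I_n -> X) (P : ('I_n -> R[i]) -> Prop) (h : ('I_n -> R[i]) -> R) :
  (exists c, unit_comb x c /\ P c) ->
  exists c, [/\ unit_comb x c, P c &
    forall d, unit_comb x d -> P d -> h c <= h d].
Proof.
pose F := {ffun 'I_n -> seq_sub (digits R)}.
pose coef (g : F) : 'I_n -> R[i] := fun j => val (g j).
have coefP c : unit_comb x c -> exists g, coef g = c.
  move=> [c_d _]; exists [ffun j => SeqSub (c_d j)].
  by apply: funext => j; rewrite /coef ffunE.
pose Q : pred F := fun g => `[< unit_comb x (coef g) /\ P (coef g) >].
move=> [c [c1 Pc]]; have [g0 g0c] := coefP c c1.
have Qg0 : Q g0 by apply/asboolP; rewrite g0c.
case: (arg_minP (fun g => h (coef g)) Qg0) => g /asboolP[g1 Pg] min_g.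
exists (coef g); split=> // d d1 Pd; have [g' g'd] := coefP d d1.
by rewrite -g'd; apply: min_g; apply/asboolP; rewrite g'd.
Qed.

(** * The height *)

(* Binary weights make the leading coefficient dominate all later ones. *)
Definition height (R : realType) (n : nat) (c : 'I_n -> R[i]) : R :=
  \sum_(j < n) 2 ^+ (n - j.+1) * (complex.Re (c j) + complex.Im (c j)).

Lemma heightB (R : realType) (n : nat) (c d : 'I_n -> R[i]) :
  height (fun j => c j - d j) = height c - height d.
Proof.
rewrite /height -sumrB; apply: eq_bigr => j _; rewrite -mulrBr.
by case: (c j) (d j) => [? ?] [? ?] /=; congr (_ * _); lra.
Qed.

Lemma heightN (R : realType) (n : nat) (c : 'I_n -> R[i]) :
  height (fun j => - c j) = - height c.
Proof.
rewrite /height -sumrN; apply: eq_bigr => j _; rewrite -mulrN.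
by case: (c j) => [? ?] /=; congr (_ * _); lra.
Qed.

(** If [k] is not the last index, the terms before the last are twice the sum for [n], hence at
    least 2 by induction, and the last term costs at most 1. *)
Lemma binary_sum_ge1 (R : realType) (n : nat) (f : 'I_n -> R) (k : 'I_n) :
  (forall j : 'I_n, (j < k)%N -> f j = 0) -> f k = 1 -> (forall j, -1 <= f j) ->
  1 <= \sum_(j < n) 2 ^+ (n - j.+1) * f j.
Proof.
elim: n f k => [|n IHn] f k f0 fk f_ge; first by case: k {f0 fk}.
rewrite big_ord_recr /= subnn expr0 mul1r.
case: (unliftP ord_max k) => [k' k_eq|k_eq]; last first.
  rewrite -k_eq fk big1 ?add0r // => j _.
  by rewrite f0 ?mulr0 // k_eq /= ltn_ord.
have k'E : k = widen_ord (leqnSn n) k'.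
  by rewrite k_eq; apply: val_inj; rewrite /= /bump leqNgt ltn_ord.
have := IHn (fun j => f (widen_ord (leqnSn n) j)) k'.
rewrite -k'E => /(_ _ fk (fun j => f_ge _)) IH.
under eq_bigr => j _ do rewrite subSn // exprS -mulrA.
rewrite -mulr_sumr; have := f_ge ord_max.
suff : 1 <= \sum_(j < n) 2 ^+ (n - j.+1) * f (widen_ord (leqnSn n) j) by lra.
by apply: IH => j jk; apply: f0; rewrite k'E.
Qed.

Lemma height_gt0 (R : realType) (n : nat) (c : 'I_n -> R[i]) (k : 'I_n)
    (u : R[i]) :
  (forall j, c j \in digits R) -> lead k u c ->
  complex.Re u + complex.Im u = 1 -> 0 < height c.
Proof.
move=> c_d [c0 ck] u1; apply: lt_le_trans ltr01 _.
apply: (binary_sum_ge1 (k := k)) => [j jk||j]; last exact: digit_sum_ge.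
  by rewrite c0 //= addr0.
by rewrite ck.
Qed.

(** * Leading units and the separated family *)

Definition lead_unit (R : realType) (b : bool) : R[i] := if b then 1 else 'i%C.

Lemma lead_unit_digit (R : realType) (b : bool) : lead_unit R b \in digits R.
Proof. by case: b; rewrite !inE eqxx ?orbT. Qed.

Lemma lead_unit_sum (R : realType) (b : bool) :
  complex.Re (lead_unit R b) + complex.Im (lead_unit R b) = 1.
Proof. by case: b; rewrite /= ?addr0 ?add0r. Qed.

Lemma lead_unit_neq0 (R : realType) (b : bool) : lead_unit R b != 0.
Proof.
by case: b; rewrite eq_complex /= oner_eq0 ?andbF.
Qed.

Lemma lead_unitD (R : realType) (b b' : bool) :
  lead_unit R b + lead_unit R b' \notin digits R.
Proof.
by case: b b' => [] []; apply/notin_digits/normc_gt1; rewrite /= !expr2; lra.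
Qed.

Lemma lead_unitB (R : realType) (b b' : bool) :
  b != b' -> lead_unit R b - lead_unit R b' \notin digits R.
Proof.
case: b b' => [] [] // _; apply/notin_digits/normc_gt1; rewrite /= !expr2; lra.
Qed.

(** [Some k] indexes the minimal elements leading at [k], and [None] the negated maximal ones. *)
Lemma separated_unit_combs (R : realType) (X : finDimBanachType R[i]) (n : nat)
    (x : 'I_n.+1 -> X) (xs : 'I_n.+1 -> {scalar X}) :
  auerbach_basis x xs ->
  exists c : option 'I_n.+1 * bool -> 'I_n.+1 -> R[i],
    (forall t, unit_comb x (c t)) /\
    (forall t t', t != t' ->
       1 < `|\sum_j c t j *: x j - \sum_j c t' j *: x j|).
Proof.
move=> hx.
have lead_ex (kb : 'I_n.+1 * bool) :
    exists c, unit_comb x c /\ lead kb.1 (lead_unit R kb.2) c.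
  apply: unit_comb_basis; [by case: hx => _ /(_ kb.1)[]|..].
    exact: lead_unit_digit.
  exact: lead_unit_neq0.
have [s sP] := choice (fun kb => unit_comb_min (@height R n.+1) (lead_ex kb)).
(* Minimising [- height] makes [t b] an element of maximal height. *)
have [t tP] :=
  choice (fun b => unit_comb_min (fun c => - height c) (lead_ex (ord0, b))).
have s_gt0 kb : 0 < height (s kb).
  by case: (sP kb) => [[dg _] /height_gt0 h _]; apply: h (lead_unit_sum _ _).
pose tN b j := - t b j.
have tN1 b : unit_comb x (tN b) by case: (tP b) => /unit_combN.
have ss_lt (k : 'I_n.+1) b (l : 'I_n.+1) b' : (k < l)%N ->
    1 < `|\sum_j s (k, b) j *: x j - \sum_j s (l, b') j *: x j|.
  move=> kl; have [sk1 [/= sk0 skk] min_sk] := sP (k, b).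
  have [sl1 [/= sl0 _] _] := sP (l, b').
  apply: (unit_combB (k := k) hx) => //.
    by rewrite skk sl0 // lead_unit_neq0.
  (* The difference still leads with the same unit at [k], but subtracting the positive height of
     [s (l, b')] puts it below the minimum. *)
  move=> /min_sk h; have := s_gt0 (l, b'); suff : lead k (lead_unit R b)
    (fun j => s (k, b) j - s (l, b') j) by move=> /h; rewrite heightB; lra.
  split=> [j jk|]; last by rewrite skk sl0 // subr0.
  by rewrite sk0 // sl0 ?subr0 // (ltn_trans jk).
have ss_eq k b b' : b != b' ->
    1 < `|\sum_j s (k, b) j *: x j - \sum_j s (k, b') j *: x j|.
  move=> bb'; have [sb1 [/= _ sbk] _] := sP (k, b).
  have [sb'1 [/= _ sb'k] _] := sP (k, b').
  (* The two entries at [k] are 1 and ['i] in some order, at distance sqrt 2. *)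
  have sBk : s (k, b) k - s (k, b') k \notin digits R.
    by rewrite sbk sb'k lead_unitB.
  apply: (unit_combB (k := k) hx) => //.
    by apply: contraNneq sBk => ->; rewrite subrr !inE eqxx.
  by case=> /(_ k); rewrite (negbTE sBk).
have st k b b' : 1 < `|\sum_j s (k, b) j *: x j - \sum_j tN b' j *: x j|.
  have [sk1 [/= sk0 skk] _] := sP (k, b).
  have [_ [/= _ t0] max_t] := tP b'.
  (* At the first coordinate two leading units add up to modulus 2 or sqrt 2. *)
  have [k0|k_gt0] := posnP k.
    have kE : k = ord0 by apply: val_inj.
    have sBk : s (k, b) ord0 - tN b' ord0 \notin digits R.
      by rewrite /tN opprK t0 -kE skk lead_unitD.
    apply: (unit_combB (k := ord0) hx) => //.
      by apply: contraNneq sBk => ->; rewrite subrr !inE eqxx.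
    by case=> /(_ ord0); rewrite (negbTE sBk).
  apply: (unit_combB (k := ord0) hx) => //.
    by rewrite /tN t0 sk0 // eq_sym oppr_eq0 lead_unit_neq0.
  (* Adding [s (k, b)], which vanishes at [ord0], keeps the leading unit of [t b'] but raises its
     maximal height. *)
  move=> /max_t h; have := s_gt0 (k, b); suff : lead ord0 (lead_unit R b')
    (fun j => s (k, b) j - tN b' j) by move=> /h; rewrite heightB heightN; lra.
  by split=> [//|]; rewrite /tN opprK t0 sk0 // add0r.
have tt b b' : b != b' ->
    1 < `|\sum_j tN b j *: x j - \sum_j tN b' j *: x j|.
  move=> bb'; have [_ [/= _ tb] _] := tP b; have [_ [/= _ tb'] _] := tP b'.
  have tBk : tN b ord0 - tN b' ord0 \notin digits R.
    by rewrite /tN opprK tb tb' addrC lead_unitB // eq_sym.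
  apply: (unit_combB (k := ord0) hx) => //.
    by apply: contraNneq tBk => ->; rewrite subrr !inE eqxx.
  by case=> /(_ ord0); rewrite (negbTE tBk).
exists (fun kb => if kb.1 is Some k then s (k, kb.2) else tN kb.2).
split=> [[[k|] b] //=|[[k|] b] [[l|] b'] /= neq //].
- by case: (sP (k, b)).
- case: (ltngtP k l) => [|lk|/val_inj kl]; first exact: ss_lt.
    by rewrite distrC; apply: ss_lt.
  by move: neq; rewrite kl => neq; apply: ss_eq; apply: contraNneq neq => ->.
- by rewrite distrC; apply: st.
- by apply: tt; apply: contraNneq neq => ->.
Qed.

Theorem theorem2p10 (R : realType) (X : finDimBanachType R[i]) (n : nat)
  (hn : (1 <= n)%N) (hdim : \dim {:X} = n)
  (x : 'I_n -> X) (xs : 'I_n -> {scalar X}) (hx : auerbach_basis x xs) :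
  exists z : 'I_(2 * n + 2) -> X,
    [/\ forall k, exists2 c : 'I_n -> R[i],
          forall j, c j \in [:: 0; 1; -1; 'i%C; - 'i%C]
          & z k = \sum_j c j *: x j,
        forall k : 'I_(2 * n + 2), `|z k| = 1
      & forall k l : 'I_(2 * n + 2), (k < l)%N -> 1 < `|z k - z l|].
Proof.
case: n hn x xs hx {hdim} => // n _ x xs /separated_unit_combs[c [c1 c_sep]].
have card_eq : (2 * n.+1 + 2)%N = #|{: option 'I_n.+1 * bool}|.
  by rewrite card_prod card_option card_ord card_bool; lia.
pose t k : option 'I_n.+1 * bool := enum_val (cast_ord card_eq k).
exists (fun k => \sum_j c (t k) j *: x j); split=> [k|k|k l kl].
- by exists (c (t k)) => // j; case: (c1 (t k)).
- by case: (c1 (t k)).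
- apply: c_sep; apply: contraTneq kl => /enum_val_inj/cast_ord_inj ->.
  by rewrite ltnn.
Qed.
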